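(* Let $\mathbf{x}=X_{\mathbf{1}}\mathbf{1}\oplus X_{\mathbf{i}}\mathbf{i}\oplus X_{\mathbf{j}}\mathbf{j}\oplus X_{\mathbf{k}}\mathbf{k}\in\mathbb{W}$ with $X_{\mathbf{1}},X_{\mathbf{i}},X_{\mathbf{j}},X_{\mathbf{k}}\in\mathbb{R}$, and suppose $\mathbf{x}\notin\mathbb{D}_\oplus$ and $\mathbf{x}\notin\mathbb{D}_\ominus$. Then the multiplicative inverse of $\mathbf{x}$ exists and is unique, and it is given by $$\mathbf{x}^{-\mathbf{1}}=\frac{\mathbf{x}^{\blacktriangle}\otimes[\mathcal{A}(\mathbf{x})\,\mathbf{1}\ominus\mathcal{B}(\mathbf{x})\,\Theta]}{[\mathcal{A}(\mathbf{x})+\mathcal{B}(\mathbf{x})][\mathcal{A}(\mathbf{x})-\mathcal{B}(\mathbf{x})]},$$ so that $\mathbf{x}\otimes\mathbf{x}^{-\mathbf{1}}=\mathbf{1}$.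
   Context: $\mathbb{W}$ is the real algebra $\mathbb{R}^4$ with standard addition $\oplus$ (subtraction is denoted $\ominus$) and scalar multiplication, standard basis $\mathbf{1}=(1,0,0,0)$, $\mathbf{i}=(0,1,0,0)$, $\mathbf{j}=(0,0,1,0)$, $\mathbf{k}=(0,0,0,1)$, and multiplication, for $\mathbf{x}=(X_{\mathbf{1}},X_{\mathbf{i}},X_{\mathbf{j}},X_{\mathbf{k}})$ and $\mathbf{y}=(Y_{\mathbf{1}},Y_{\mathbf{i}},Y_{\mathbf{j}},Y_{\mathbf{k}})$, $$\mathbf{x}\otimes\mathbf{y}=(X_{\mathbf{1}}Y_{\mathbf{1}}-X_{\mathbf{i}}Y_{\mathbf{k}}-X_{\mathbf{j}}Y_{\mathbf{j}}-X_{\mathbf{k}}Y_{\mathbf{i}})\,\mathbf{1}\oplus(X_{\mathbf{1}}Y_{\mathbf{i}}+X_{\mathbf{i}}Y_{\mathbf{1}}-X_{\mathbf{j}}Y_{\mathbf{k}}-X_{\mathbf{k}}Y_{\mathbf{j}})\,\mathbf{i}\oplus(X_{\mathbf{1}}Y_{\mathbf{j}}+X_{\mathbf{i}}Y_{\mathbf{i}}+X_{\mathbf{j}}Y_{\mathbf{1}}-X_{\mathbf{k}}Y_{\mathbf{k}})\,\mathbf{j}\oplus(X_{\mathbf{1}}Y_{\mathbf{k}}+X_{\mathbf{i}}Y_{\mathbf{j}}+X_{\mathbf{j}}Y_{\mathbf{i}}+X_{\mathbf{k}}Y_{\mathbf{1}})\,\mathbf{k}.$$ The $\blacktriangle$-conjugation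 is $\mathbf{x}^{\blacktriangle}=X_{\mathbf{1}}\mathbf{1}\ominus X_{\mathbf{k}}\mathbf{i}\ominus X_{\mathbf{j}}\mathbf{j}\ominus X_{\mathbf{i}}\mathbf{k}$. Put $\Theta=\frac{1}{\sqrt2}(\mathbf{i}\ominus\mathbf{k})=\frac1{\sqrt2}(0,1,0,-1)$, $\mathcal{A}(\mathbf{x})=X_{\mathbf{1}}^2+X_{\mathbf{i}}^2+X_{\mathbf{j}}^2+X_{\mathbf{k}}^2$ and $\mathcal{B}(\mathbf{x})=\sqrt2\,(X_{\mathbf{1}}X_{\mathbf{i}}+X_{\mathbf{i}}X_{\mathbf{j}}+X_{\mathbf{j}}X_{\mathbf{k}}-X_{\mathbf{k}}X_{\mathbf{1}})$; $\mathbb{D}_\oplus=\{\mathbf{x}\in\mathbb{W}:\mathcal{A}(\mathbf{x})-\mathcal{B}(\mathbf{x})=0\}$, $\mathbb{D}_\ominus=\{\mathbf{x}\in\mathbb{W}:\mathcal{A}(\mathbf{x})+\mathcal{B}(\mathbf{x})=0\}$. *)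

(* Defs.v *)
From HB Require Import structures.
From mathcomp Require Import all_boot all_order all_algebra.
From mathcomp Require Import classical_sets reals.

Set Implicit Arguments.
Unset Strict Implicit.
Unset Printing Implicit Defensive.

Import Order.TTheory GRing.Theory Num.Theory.
Local Open Scope ring_scope.
Local Open Scope classical_set_scope.

(* The algebra W is carried by 'rV[R]_4, whose addition, subtraction and
   scaling are the library's; the coordinates 0, 1, 2, 3 : 'I_4 are those
   along 1, i, j, k. *)
Section Algebra.
Variable R : realType.
Implicit Types x y : 'rV[R]_4.

Definition oneW : 'rV[R]_4 := delta_mx 0 0.
Definition iW : 'rV[R]_4 := delta_mx 0 1.
Definition jW : 'rV[R]_4 := delta_mx 0 2.
Definition kW : 'rV[R]_4 := delta_mx 0 3.

Definition co1 x : R := x 0 0.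
Definition coi x : R := x 0 1.
Definition coj x : R := x 0 2.
Definition cok x : R := x 0 3.

Definition mulW x y : 'rV[R]_4 :=
    (co1 x * co1 y - coi x * cok y - coj x * coj y - cok x * coi y) *: oneW
  + (co1 x * coi y + coi x * co1 y - coj x * cok y - cok x * coj y) *: iW
  + (co1 x * coj y + coi x * coi y + coj x * co1 y - cok x * cok y) *: jW
  + (co1 x * cok y + coi x * coj y + coj x * coi y + cok x * co1 y) *: kW.

Definition conjW x : 'rV[R]_4 :=
  co1 x *: oneW - cok x *: iW - coj x *: jW - coi x *: kW.

Definition ThetaW : 'rV[R]_4 := (1 / Num.sqrt 2) *: (iW - kW).

Definition calA x : R := co1 x ^+ 2 + coi x ^+ 2 + coj x ^+ 2 + cok x ^+ 2.

Definition calB x : R :=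
  Num.sqrt 2 * (co1 x * coi x + coi x * coj x + coj x * cok x - cok x * co1 x).

Definition Dplus : set 'rV[R]_4 := [set x | calA x - calB x = 0].
Definition Dminus : set 'rV[R]_4 := [set x | calA x + calB x = 0].

Definition is_inverseW x y : Prop := mulW x y = oneW /\ mulW y x = oneW.

End Algebra.

Arguments oneW {R}.
Arguments iW {R}.
Arguments jW {R}.
Arguments kW {R}.
Arguments ThetaW {R}.
Arguments Dplus {R}.
Arguments Dminus {R}.

Notation "x *w y" := (mulW x y) (at level 40, left associativity) : ring_scope.

(* Main.v *)
(** With t = i one has j = t^2, k = t^3 and t^4 = -1, so W is the commutative
    algebra R[t]/(t^4 + 1), and the conjugation is the automorphism t |-> t^-1.
    Hence x x^conj is fixed by it and equals A(x) 1 + B(x) Theta; as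
    Theta^2 = 1, multiplying by A(x) 1 - B(x) Theta gives the scalar
    A(x)^2 - B(x)^2, which is nonzero off D_plus and D_minus. *)
Require Import Defs.
From mathcomp Require Import all_boot all_order all_algebra.
From mathcomp Require Import classical_sets reals.
From mathcomp Require Import ring.

Import Order.TTheory GRing.Theory Num.Theory.
Local Open Scope ring_scope.

Section AlgebraW.
Variable R : realType.
Implicit Types x y z : 'rV[R]_4.

(** Reduces an identity in W to four scalar identities over [R], which [ring] or [field] can
    settle. *)
Lemma eqW x y : co1 x = co1 y -> coi x = coi y -> coj x = coj y ->
  cok x = cok y -> x = y.
Proof.
move=> e1 ei ej ek; apply/rowP => -[[|[|[|[|//]]]] lti].
(* The literals of ['I_4] carry other bound proofs than [lti], so the indices are compared by
   value. *)
- by rewrite (_ : Ordinal lti = 0) //; exact: val_inj.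
- by rewrite (_ : Ordinal lti = 1) //; exact: val_inj.
- by rewrite (_ : Ordinal lti = 2) //; exact: val_inj.
- by rewrite (_ : Ordinal lti = 3) //; exact: val_inj.
Qed.

Lemma co1E : (forall x y, co1 (x + y) = co1 x + co1 y) *
  (forall x, co1 (- x) = - co1 x) * (forall a x, co1 (a *: x) = a * co1 x).
Proof. by rewrite /co1; do !split=> *; rewrite !mxE. Qed.

Lemma coiE : (forall x y, coi (x + y) = coi x + coi y) *
  (forall x, coi (- x) = - coi x) * (forall a x, coi (a *: x) = a * coi x).
Proof. by rewrite /coi; do !split=> *; rewrite !mxE. Qed.

Lemma cojE : (forall x y, coj (x + y) = coj x + coj y) *
  (forall x, coj (- x) = - coj x) * (forall a x, coj (a *: x) = a * coj x).
Proof. by rewrite /coj; do !split=> *; rewrite !mxE. Qed.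

Lemma cokE : (forall x y, cok (x + y) = cok x + cok y) *
  (forall x, cok (- x) = - cok x) * (forall a x, cok (a *: x) = a * cok x).
Proof. by rewrite /cok; do !split=> *; rewrite !mxE. Qed.

Lemma co_oneW : (co1 (@oneW R) = 1) * (coi (@oneW R) = 0) *
  (coj (@oneW R) = 0) * (cok (@oneW R) = 0).
Proof. by rewrite /co1 /coi /coj /cok !mxE. Qed.

Lemma co_iW : (co1 (@iW R) = 0) * (coi (@iW R) = 1) *
  (coj (@iW R) = 0) * (cok (@iW R) = 0).
Proof. by rewrite /co1 /coi /coj /cok !mxE. Qed.

Lemma co_jW : (co1 (@jW R) = 0) * (coi (@jW R) = 0) *
  (coj (@jW R) = 1) * (cok (@jW R) = 0).
Proof. by rewrite /co1 /coi /coj /cok !mxE. Qed.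

Lemma co_kW : (co1 (@kW R) = 0) * (coi (@kW R) = 0) *
  (coj (@kW R) = 0) * (cok (@kW R) = 1).
Proof. by rewrite /co1 /coi /coj /cok !mxE. Qed.

Definition coWE := (co1E, coiE, cojE, cokE, co_oneW, co_iW, co_jW, co_kW).

(** Multiplying two cubics in t, the terms of degree 4 to 6 wrap around with a minus sign, as t^4 =
    -1. *)
Lemma co_mulW x y :
  (co1 (x *w y) =
     co1 x * co1 y - coi x * cok y - coj x * coj y - cok x * coi y) *
  (coi (x *w y) =
     co1 x * coi y + coi x * co1 y - coj x * cok y - cok x * coj y) *
  (coj (x *w y) =
     co1 x * coj y + coi x * coi y + coj x * co1 y - cok x * cok y) *
  (cok (x *w y) =
     co1 x * cok y + coi x * coj y + coj x * coi y + cok x * co1 y).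
Proof. by rewrite /mulW; do !split; rewrite !coWE; ring. Qed.

(** Since t^-1 = -t^3, t^-2 = -t^2 and t^-3 = -t, the coordinates along i and k trade places. *)
Lemma co_conjW x : (co1 (conjW x) = co1 x) * (coi (conjW x) = - cok x) *
  (coj (conjW x) = - coj x) * (cok (conjW x) = - coi x).
Proof. by rewrite /conjW; do !split; rewrite !coWE; ring. Qed.

Lemma mulWC x y : x *w y = y *w x.
Proof. by apply: eqW; rewrite !co_mulW; ring. Qed.

Lemma mulWA x y z : x *w (y *w z) = x *w y *w z.
Proof. by apply: eqW; rewrite !co_mulW; ring. Qed.

Lemma mulW1 x : x *w oneW = x.
Proof. by apply: eqW; rewrite !co_mulW !coWE; ring. Qed.

Lemma mulWZr (a : R) x y : x *w (a *: y) = a *: (x *w y).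
Proof. by apply: eqW; rewrite !(co_mulW, coWE); ring. Qed.

Lemma mulWZl (a : R) x y : (a *: x) *w y = a *: (x *w y).
Proof. by rewrite mulWC mulWZr mulWC. Qed.

Lemma mulWDl x y z : (x + y) *w z = x *w z + y *w z.
Proof. by apply: eqW; rewrite !(co_mulW, coWE); ring. Qed.

Lemma mulWDr x y z : x *w (y + z) = x *w y + x *w z.
Proof. by rewrite mulWC mulWDl ![_ *w x]mulWC. Qed.

(** The monoid argument y = y (x z) = (y x) z = z. *)
Lemma is_inverseW_unique x y z : is_inverseW x y -> is_inverseW x z -> y = z.
Proof.
by move=> [_ yx1] [xz1 _]; rewrite -[y]mulW1 -xz1 mulWA yx1 mulWC mulW1.
Qed.

Lemma sqrt2_neq0 : Num.sqrt 2 != 0 :> R.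
Proof. by rewrite gt_eqF // sqrtr_gt0 ltr0n. Qed.

(** The fixed space of t |-> t^-1 is spanned by 1 and t - t^3; the root in [calB] cancels the factor
    1 / sqrt 2 of [ThetaW]. *)
Lemma mulW_conj x : x *w conjW x = calA x *: oneW + calB x *: ThetaW.
Proof.
by apply: eqW; rewrite /ThetaW /calA /calB !(co_mulW, co_conjW, coWE);
  field; exact: sqrt2_neq0.
Qed.

(** Here (t - t^3)^2 = t^2 - 2 t^4 + t^6 = 2, because t^6 = -t^2. *)
Lemma mulW_Theta : ThetaW *w ThetaW = oneW :> 'rV[R]_4.
Proof.
have s2 : (1 / Num.sqrt 2) ^+ 2 = 2^-1 :> R.
  by rewrite div1r exprVn sqr_sqrtr ?ler0n.
(* Both scalars are pulled out and merged first, so that no square root is left for [field]. *)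
rewrite /ThetaW mulWZl mulWZr scalerA -expr2 s2.
by apply: eqW; rewrite !(co_mulW, coWE); field.
Qed.

(** The cross terms in Theta cancel, and Theta^2 = 1 makes the remaining b^2 term a scalar. *)
Lemma mulW_difference_of_squares (a b : R) :
  (a *: oneW + b *: ThetaW) *w (a *: oneW - b *: ThetaW) =
  ((a + b) * (a - b)) *: oneW.
Proof.
(* [ThetaW] unfolds to a scaled vector, on which [mulWZl] would fire. *)
move: ThetaW mulW_Theta => t tt.
rewrite -[in LHS]scaleNr mulWDl !mulWDr !(mulWZl, mulWZr).
rewrite tt [oneW *w t]mulWC !mulW1.
by apply: eqW; rewrite !coWE; ring.
Qed.

End AlgebraW.

Theorem theorem10 (R : realType) (x : 'rV[R]_4)
    (hplus : ~ Dplus x) (hminus : ~ Dminus x) :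
  (exists! y : 'rV[R]_4, is_inverseW x y) /\
  (forall y : 'rV[R]_4, is_inverseW x y ->
     y = ((calA x + calB x) * (calA x - calB x))^-1 *:
           (conjW x *w (calA x *: oneW - calB x *: ThetaW)) /\
     x *w y = oneW).
Proof.
set y0 := _ *: (conjW x *w _).
have nz : (calA x + calB x) * (calA x - calB x) != 0.
  (* [Dminus] is the zero set of the first factor, [Dplus] that of the second. *)
  by apply/mulf_neq0; apply/eqP.
have xy0 : x *w y0 = oneW.
  rewrite /y0 mulWZr mulWA mulW_conj mulW_difference_of_squares.
  by rewrite scalerA mulVf // scale1r.
(* Commutativity makes the right inverse two-sided. *)
have inv0 : is_inverseW x y0 by split; rewrite // mulWC.
split; first by exists y0; split=> // y; exact: is_inverseW_unique.
by move=> y invy; split; [exact: is_inverseW_unique _ _ _ _ invy inv0 | case: invy].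
Qed.
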